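(* Let $1\le\ell\le s-1$. Suppose that $\mathscr Y_\ell$ is covered by $m_\ell$ intervals $[A_{\ell,i},B_{\ell,i}]$, $i=1,\dots,m_\ell$, such that $$\bigcup_{i=1}^{m_\ell}[A_{\ell,i},B_{\ell,i}]=\mathscr Y_\ell,\qquad B_{\ell,i}\le A_{\ell,i+1},\quad i=1,\dots,m_\ell-1,$$ and $$(1-\varepsilon_\ell)h_{\ell,i}<g_\ell(y)\le(1+\varepsilon_\ell)h_{\ell,i}\quad\text{for all }y\in[A_{\ell,i},B_{\ell,i}],\ i=1,\dots,m_\ell.$$ Let $\underline I(a,b,c,d)$ and $\overline I(a,b,c,d)$ be multivariate functions such that $\underline I(a,b,c,d)\le\int_a^bf_{Z_\ell}(y-u)\,du\le\overline I(a,b,c,d)$ for any $y\in[c,d]$ and that $\overline I(a,b,c,d)-\underline I(a,b,c,d)\to0$ as $d-c\to0$. Let $\eta_\ell$ and $\gamma_\ell$ be positive numbers such that $(1+\gamma_\ell)(1-\eta_\ell)>1+\eta_\ell$ and $$\varepsilon_\ell\le\frac{2}{1+\frac{1-\varepsilon_{\ell+1}}{1+\varepsilon_{\ell+1}}\cdot\frac{(1+\eta_\ell)(1+\gamma_\ell)}{1-\eta_\ell}}-1.$$ Let $[C,D]\subseteq\mathscr Y_{\ell+1}$ and let $\overline L_\ell,\overline U_\ell,\underline L_\ell,\underline U_\ell$ be positive real numbers such that $$\overline L_\ell<\sum_{i=1}^{m_\ell}h_{\ell,i}\,\overline I(A_{\ell,i},B_{\ell,i},C,D)<\overline U_\ell<\frac{1+\eta_\ell}{1-\eta_\ell}\,\overline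 L_\ell,$$ $$\underline U_\ell>\sum_{i=1}^{m_\ell}h_{\ell,i}\,\underline I(A_{\ell,i},B_{\ell,i},C,D)>\underline L_\ell>\frac{1-\eta_\ell}{1+\eta_\ell}\,\underline U_\ell.$$ Define $$h_{\ell+1}=\tfrac14\left[(1+\varepsilon_\ell)(1+\eta_\ell)(\overline L_\ell+\overline U_\ell)+(1-\varepsilon_\ell)(1-\eta_\ell)(\underline L_\ell+\underline U_\ell)\right].$$ Then $(1-\varepsilon_{\ell+1})h_{\ell+1}<g_{\ell+1}(y)<(1+\varepsilon_{\ell+1})h_{\ell+1}$ for any $y\in[C,D]$ provided that $$(1+\gamma_\ell)(\underline L_\ell+\underline U_\ell)>\overline L_\ell+\overline U_\ell,$$ and this last inequality can be satisfied if $D-C$ is sufficiently small.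
   Context: $Y_1,\dots,Y_s$ are random variables with mutually independent increments: with $Z_\ell=Y_{\ell+1}-Y_\ell$ ($\ell=1,\dots,s-1$), the variables $Z_1,\dots,Z_{s-1}$ are mutually independent and $Z_\ell$ is independent of $Y_1,\dots,Y_\ell$. $f_{Z_\ell}$ is the probability density function of $Z_\ell$, assumed differentiable. $\mathscr Y_\ell$ is a subset of the support of $Y_\ell$. For $\ell=1,\dots,s$, $g_\ell(y)=\frac{d}{dy}\Pr\{Y_\ell<y;\ Y_i\in\mathscr Y_i,\ i=1,\dots,\ell-1\}$; thus $g_1$ is the density of $Y_1$ and $g_{\ell+1}(y)=\int_{u\in\mathscr Y_\ell}f_{Z_\ell}(y-u)g_\ell(u)\,du$ for $y\in\mathscr Y_{\ell+1}$. The numbers $\varepsilon_\ell$ satisfy $0<\varepsilon_1<\varepsilon_2<\dots<\varepsilon_s<1$, and $h_{\ell,i}$ are real numbers. *)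

(* Defs.v *)
From HB Require Import structures.
From mathcomp Require Export all_boot all_order all_algebra.
From mathcomp Require Export all_classical all_reals all_analysis.
Export Order.TTheory GRing.Theory Num.Theory.
Export numFieldNormedType.Exports.

Set Implicit Arguments.
Unset Strict Implicit.
Unset Printing Implicit Defensive.

Local Open Scope classical_set_scope.
Local Open Scope ring_scope.

(* Sequences Y_1, ..., Y_s are indexed from 1; values outside the stated range
   of indices are irrelevant. *)
Definition increment (T : Type) (R : realType) (Y : nat -> T -> R) (j : nat) :
  T -> R := fun w => Y j.+1 w - Y j w.

Section defs.
Context {d : measure_display} {T : measurableType d} {R : realType}.
Variable P : probability T R.

Definition mutually_independent (I : set nat) (X : nat -> T -> R) : Prop :=
  forall r : seq nat, uniq r -> [set` r] `<=` I ->
  forall B : nat -> set R, (forall j, measurable (B j)) ->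
    P (\bigcap_(j in [set` r]) (X j @^-1` B j)) =
    (\prod_(j <- r) P (X j @^-1` B j))%E.

(* Independence of Z from the whole vector (Y_i)_(i in I), tested on the
   boxes, which generate the sigma-algebra of the vector. *)
Definition independent_of_family (I : set nat) (Z : T -> R)
    (Y : nat -> T -> R) : Prop :=
  forall (A : set R) (B : nat -> set R),
    measurable A -> (forall i, measurable (B i)) ->
    P ((Z @^-1` A) `&` \bigcap_(i in I) (Y i @^-1` B i)) =
    (P (Z @^-1` A) * P (\bigcap_(i in I) (Y i @^-1` B i)))%E.

Definition independent_increments (s : nat) (Y : nat -> T -> R) : Prop :=
  mutually_independent [set j | (1 <= j < s)%N] (increment Y) /\
  forall l, (1 <= l < s)%N ->
    independent_of_family [set i | (1 <= i <= l)%N] (increment Y l) Y.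

Definition is_density (X : T -> R) (f : R -> R) : Prop :=
  [/\ measurable_fun setT f, (forall x, 0 <= f x) &
      forall B : set R, measurable B ->
        P (X @^-1` B) = (\int[@lebesgue_measure R]_(x in B) (f x)%:E)%E].

Definition RV_support (X : T -> R) : set R :=
  [set x | forall e : R, 0 < e -> (0 < P (X @^-1` ball x e))%E].

(* Pr{Y_j < y; Y_i in S_i, i = 1, ..., j-1} *)
Definition restricted_cdf (Y : nat -> T -> R) (S : nat -> set R) (j : nat)
    (y : R) : R :=
  fine (P [set w | Y j w < y /\
                   forall i, (1 <= i < j)%N -> S i (Y i w)]).

(* g_j(y) = d/dy Pr{Y_j < y; Y_i in S_i, i < j}, with g_1 a density of Y_1.
   At points where the derivative does not exist (e.g. a boundary point of the
   support of Y_1) the value of g_j is left unconstrained. *)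
Definition is_restricted_density_seq (s : nat) (Y : nat -> T -> R)
    (S : nat -> set R) (g : nat -> R -> R) : Prop :=
  is_density (Y 1%N) (g 1%N) /\
  forall j y, (1 <= j <= s)%N ->
    derivable (restricted_cdf Y S j) y 1 ->
    g j y = derive1 (restricted_cdf Y S j) y.

End defs.

Section bounds.
Context {R : realType}.

(* Ilo, Ihi bound u |-> f (y - u) integrated over [a, b], for y in [c, d], and
   for fixed a, b their gap tends to 0 as d - c -> 0 (c < d). *)
Definition integral_bounds (f : R -> R) (Ilo Ihi : R -> R -> R -> R -> R) :
    Prop :=
  (forall a b c d y, a <= b -> y \in `[c, d] ->
     Ilo a b c d <= \int[@lebesgue_measure R]_(u in `[a, b]) f (y - u)
     /\ \int[@lebesgue_measure R]_(u in `[a, b]) f (y - u) <= Ihi a b c d) /\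
  (forall a b, a <= b -> forall e : R, 0 < e ->
     exists2 delta : R, 0 < delta &
       forall c d, 0 < d - c < delta ->
         `|Ihi a b c d - Ilo a b c d| < e).

(* Here Shi = \sum_i h_i Ihi(A_i, B_i, C, D), Slo is the same with Ilo, and
   Lhi, Uhi, Llo, Ulo are the constants written with an over-, resp.
   underline. *)
Definition bracketing (eta Shi Slo Lhi Uhi Llo Ulo : R) : Prop :=
  [/\ [/\ 0 < Lhi, 0 < Uhi, 0 < Llo & 0 < Ulo],
      [/\ Lhi < Shi, Shi < Uhi & Uhi < (1 + eta) / (1 - eta) * Lhi] &
      [/\ Ulo > Slo, Slo > Llo & Llo > (1 - eta) / (1 + eta) * Ulo]].

Definition weighted_sum (m : nat) (h A B : nat -> R)
    (I : R -> R -> R -> R -> R) (C D : R) : R :=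
  \sum_(1 <= i < m.+1) h i * I (A i) (B i) C D.

Definition next_h (eps eta Lhi Uhi Llo Ulo : R) : R :=
  4^-1 * ((1 + eps) * (1 + eta) * (Lhi + Uhi)
          + (1 - eps) * (1 - eta) * (Llo + Ulo)).

End bounds.

(* Main.v *)
(* Let mu_l(B) = Pr{Y_l in B; Y_i in S_i for i < l}. By independence the law
   mu_(l+1) is the convolution of f_l with mu_l restricted to S_l, so it has the
   density k(x) = int_(S_l) f_l(x - u) mu_l(du). In particular every mu_l is
   absolutely continuous, and Lebesgue differentiation identifies g_l almost
   everywhere with its Radon-Nikodym derivative; the bounds on g_l then compare
   k with the sum of the h_i int_(A_i)^(B_i) f_l(x - u) du up to the factors
   1 -+ eps_l. Since S_l is bounded and f_l continuous, k is continuous, hence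
   g_(l+1) = k at every point, whatever version of g_l was chosen. The rest is
   elementary algebra on the constants. *)
Require Import Defs.
From HB Require Import structures.
From mathcomp Require Import measurable_realfun zify ring lra.

Set Implicit Arguments.
Unset Strict Implicit.
Unset Printing Implicit Defensive.

Local Open Scope classical_set_scope.
Local Open Scope ring_scope.

(** * Convolutions *)

Section lebesgue_shift.
Context {R : realType}.
Local Notation mu := (@lebesgue_measure R).

(** Lebesgue measure is determined by its values on the intervals []a, b]], and a translation
    preserves their length. *)
Lemma lebesgue_measure_shift (c : R) (A : set R) : measurable A ->
  pushforward mu ((fun x => x + c) : R -> measurableTypeR R) A = mu A.
Proof.
move=> mA; apply/esym/lebesgue_measure_unique => //=.
  exact: measurable_funD.
move=> _ _ [[a b]] _ <-; rewrite /pushforward.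
rewrite (_ : _ @^-1` _ = `]a - c, b - c]%classic); last first.
  by apply/seteqP; split => x /=; rewrite !in_itv/= ltrBlDr lerBrDr.
rewrite !lebesgue_measure_itv/= !lte_fin ltrD2r.
by case: ifP => // _; congr EFin; ring.
Qed.

Lemma ge0_integral_shift (c : R) (f : R -> \bar R) :
  measurable_fun [set: R] f -> (forall x, 0 <= f x)%E ->
  (\int[mu]_x f (x + c)%R = \int[mu]_x f x)%E.
Proof.
move=> mf f0.
pose phi : measurableTypeR R -> measurableTypeR R := fun x : R => x + c.
have mphi : measurable_fun setT phi by exact: measurable_funD.
transitivity (\int[pushforward mu phi]_x f x)%E.
  have e := ge0_integral_pushforward mphi mu measurableT mf (fun x _ => f0 x).
  exact: (esym e).
by apply: eq_measure_integral => //= A mA _; exact: lebesgue_measure_shift.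
Qed.

End lebesgue_shift.

(** * Laws of random variables restricted to an event *)

Section restricted_law.
Context d d' (T : measurableType d) (T' : measurableType d') (R : realType).
Variables (P : probability T R) (E : set T) (X : T -> T').

(* The two proofs are arguments only so that the measure instance can be
   inferred. *)
Definition restricted_law of measurable E & measurable_fun [set: T] X :=
  fun B : set T' => P (X @^-1` B `&` E).

Hypotheses (mE : measurable E) (mX : measurable_fun [set: T] X).
Local Notation law := (restricted_law mE mX).

Let mpre (B : set T') : measurable B -> measurable (X @^-1` B).
Proof. by move=> mB; rewrite -[X in measurable X]setTI; exact: mX. Qed.

Let law0 : law set0 = 0%E.
Proof. by rewrite /restricted_law preimage_set0 set0I measure0. Qed.

Let law_ge0 B : (0 <= law B)%E.
Proof. exact: measure_ge0. Qed.

Let law_sigma_additive : semi_sigma_additive law.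
Proof.
move=> F mF tF mUF; rewrite /restricted_law preimage_bigcup setI_bigcupl.
apply: measure_semi_sigma_additive.
- by move=> n; apply: measurableI => //; exact: mpre.
- apply/trivIsetP => /= i j _ _ ij; rewrite setIACA setIid -preimage_setI.
  by move/trivIsetP : tF => /(_ _ _ _ _ ij) ->//; rewrite preimage_set0 set0I.
- rewrite -setI_bigcupl -preimage_bigcup; apply: measurableI => //; exact: mpre.
Qed.

HB.instance Definition _ := isMeasure.Build _ _ _ law
  law0 law_ge0 law_sigma_additive.

Let law_fin : fin_num_fun law.
Proof.
move=> B mB; rewrite ge0_fin_numE//; apply: le_lt_trans (ltry 1).
by apply: probability_le1; apply: measurableI => //; exact: mpre.
Qed.

HB.instance Definition _ := Measure_isFinite.Build _ _ _ law law_fin.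

End restricted_law.

(* Lebesgue measure lives on [measurableTypeR R], whose display differs from the
   one inferred for [R]; the law is put there so that both can be combined. *)
Definition real_law d (T : measurableType d) (R : realType)
    (P : probability T R) (E : set T) (X : T -> R) (mE : measurable E)
    (mX : measurable_fun [set: T] X) :
    {finite_measure set (measurableTypeR R) -> \bar R} :=
  @restricted_law _ _ _ (measurableTypeR R) _ P _ _ mE mX.

Lemma measurable_difference_kernel (R : realType) (S : set R) (f : R -> R) :
  measurable S -> measurable_fun [set: R] f ->
  measurable_fun [set: (measurableTypeR R * measurableTypeR R)%type]
    (fun p : R * R => \1_S p.1 * f (p.2 - p.1)).
Proof.
move=> mS mf; apply: measurable_funM.
  by apply: (@measurableT_comp _ _ _ _ _ _ (\1_S : R -> R)) => //.
by apply: (measurableT_comp mf); exact: (@measurable_funB _ _ R setT snd fst).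
Qed.

(** The integrand is nonnegative and jointly measurable in (w, x), so Tonelli makes its partial
    integral measurable in x. *)
Lemma measurable_convolution (R : realType)
    (nu : {sigma_finite_measure set (measurableTypeR R) -> \bar R})
    (S : set R) (f : R -> R) :
  measurable S -> measurable_fun [set: R] f -> (forall x, 0 <= f x) ->
  measurable_fun [set: R] (fun x => \int[nu]_(w in S) (f (x - w))%:E)%E.
Proof.
move=> mS mf f0.
pose h (p : measurableTypeR R * measurableTypeR R) : \bar R :=
  (\1_S p.1 * f ((p.2 : R) - p.1))%:E.
have mh : measurable_fun setT h.
  by apply/measurable_EFinP; exact: measurable_difference_kernel.
rewrite (_ : (fun x => _) = fubini_G nu h).
  by apply: measurable_fun_fubini_tonelli_G => // p; rewrite lee_fin mulr_ge0.
apply/funext => x; rewrite /fubini_G [LHS]integral_mkcond.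
apply: eq_integral => w _; rewrite /h /patch/= indicE.
by case: ifPn => _; rewrite ?mul1r ?mul0r.
Qed.

(** * Law of an independent sum *)

Section sum_law.
Context d (T : measurableType d) (R : realType) (P : probability T R).
Local Notation mu := (@lebesgue_measure R).
Variables (E : set T) (W Z : T -> R) (S : set R) (f : R -> R).
Hypotheses (mE : measurable E) (mW : measurable_fun [set: T] W)
  (mZ : measurable_fun [set: T] Z) (mS : measurable S).
Hypothesis Zf : is_density P Z f.
Hypothesis indep : forall A B : set R, measurable A -> measurable B ->
  P ((Z @^-1` A) `&` (W @^-1` B `&` E)) =
  (P (Z @^-1` A) * P (W @^-1` B `&` E))%E.

Local Notation RR := (measurableTypeR R * measurableTypeR R)%type.

Let mWZ : measurable_fun [set: T] ((fun t => (W t, Z t)) : T -> RR).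
Proof. exact: measurable_fun_pair. Qed.

(** A product measure is determined by rectangles, where the equality is exactly [indep]. *)
Let joint_law (C : set RR) : measurable C ->
  restricted_law P mE mWZ C =
  (real_law P mE mW \x real_law P measurableT mZ)%E C.
Proof.
move=> mC; apply/esym/product_measure_unique => // A B mA mB.
change (P ((fun t => (W t, Z t)) @^-1` (A `*` B) `&` E) =
  P (W @^-1` A `&` E) * P (Z @^-1` B `&` setT))%E.
rewrite setIT muleC -indep//; congr (P _).
by apply/seteqP; split=> [t [[? ?] ?]|t [? [? ?]]].
Qed.

(** The event says that (W, Z) falls in a set of the plane. Its mass under the product law is an
    iterated integral; substituting z = x - w and exchanging the order by Tonelli gives the
    convolution. *)
Lemma sum_law (B : set R) : measurable B ->
  P ((W \+ Z) @^-1` B `&` (W @^-1` S `&` E)) =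
  (\int[mu]_(x in B) \int[real_law P mE mW]_(w in S) (f (x - w))%:E)%E.
Proof.
move=> mB; have [mf f0 fZ] := Zf.
pose C : set RR := [set p : RR | B ((p.1 : R) + p.2) /\ S p.1].
have mC : measurable C.
  rewrite (_ : C =
    ((fun p : RR => (p.1 : R) + p.2) @^-1` B) `&` (fst @^-1` S))//.
  apply: measurableI; rewrite -[X in measurable X]setTI.
    exact: (@measurable_funD _ RR R setT fst snd).
  exact: measurable_fst.
transitivity (restricted_law P mE mWZ C).
  rewrite /restricted_law; congr (P _).
  by apply/seteqP; split=> [t [? [? ?]]|t [[? ?] ?]].
rewrite joint_law//.
pose h (p : RR) : \bar R := (\1_S p.1 * (\1_B p.2 * f ((p.2 : R) - p.1)))%:E.
have mh : measurable_fun setT h.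
  rewrite (_ : h = fun p : RR =>
    (\1_B p.2 * (\1_S p.1 * f ((p.2 : R) - p.1)))%:E); last first.
    by apply/funext => p; rewrite /h mulrCA.
  apply/measurable_EFinP; apply: measurable_funM.
    exact: (@measurableT_comp _ _ _ _ _ _ (\1_B : R -> R)).
  exact: measurable_difference_kernel.
have h0 p : (0 <= h p)%E by rewrite lee_fin !mulr_ge0.
transitivity (\int[real_law P mE mW]_w \int[mu]_x h (w, x))%E.
  rewrite /product_measure1/=; apply: eq_integral => w _ /=.
  change (P (Z @^-1` xsection C w `&` setT) = \int[mu]_x h (w, x))%E.
  rewrite setIT fZ; last exact: measurable_xsection.
  rewrite integral_mkcond.
  (* The substitution z = x - w in the integral of [f] over the section of [C] at [w]. *)
  rewrite -[LHS](@ge0_integral_shift _ (- w)).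
  - apply: eq_integral => x _; rewrite /patch /h/= !indicE.
    case: ifPn; rewrite ?notin_setE ?inE /xsection/= ?inE /C /= addrC subrK.
      by move=> [? ?]; rewrite !mem_set// !mul1r.
    case/not_andP => ?.
      by rewrite (@memNset _ B)// mul0r mulr0.
    by rewrite (@memNset _ S)// mul0r.
  - by apply/(measurable_restrictT _ _).1; [exact: measurable_xsection|
      apply/measurable_funTS/measurable_EFinP].
  - by move=> x; apply: erestrict_ge0 => z _; rewrite lee_fin.
rewrite (@fubini_tonelli _ _ _ _ _ (real_law P mE mW) mu h)//.
rewrite [RHS]integral_mkcond; apply: eq_integral => x _.
rewrite /patch; case: ifPn => xB; last first.
  rewrite integral0_eq// => w _.
  by rewrite /h /= (indicE _ B) (negbTE xB) mul0r mulr0.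
rewrite [RHS]integral_mkcond; apply: eq_integral => w _.
rewrite /h /patch/= !indicE xB mul1r.
by case: ifPn => wS; rewrite ?mul1r ?mul0r.
Qed.

End sum_law.

(** * Continuity of convolutions over a bounded set *)

Section compact_convolution.
Context {R : realType}.
Variables (nu : {finite_measure set (measurableTypeR R) -> \bar R}).
Variables (S : set R) (a b : R) (f : R -> R).
Hypotheses (mS : measurable S) (Sab : S `<=` `[a, b]) (cf : continuous f).

Let mf x : measurable_fun S (fun w : R => f (x - w)).
Proof.
apply: measurable_funTS; apply: measurableT_comp.
  exact: continuous_measurable_fun.
exact: measurable_funB.
Qed.

Let bounded (u v : R) : exists M : R, forall x w,
  u <= x <= v -> S w -> `|f (x - w)| <= M.
Proof.
have : bounded_set (f @` `[u - b, v - a]).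
  apply: compact_bounded.
  apply: continuous_compact; last exact: segment_compact.
  exact: continuous_subspaceT.
(* [bounded_set] only provides bounds strictly above [M], hence [M + 1]. *)
move=> [M [Mr HM]]; exists (M + 1) => x w /andP[ux xv] /Sab.
rewrite /= in_itv/= => /andP[aw wb].
apply: (HM (M + 1)); first by rewrite ltrDl.
by exists (x - w) => //; rewrite /= in_itv/= !lerB.
Qed.

Lemma integrable_compact_convolution (x : R) :
  nu.-integrable S (fun w : R => (f (x - w))%:E).
Proof.
have [M HM] := bounded x x.
apply: (@le_integrable _ _ _ nu S mS _ (EFin \o cst M)).
- by apply/measurable_EFinP; exact: mf.
- move=> w Sw /=; rewrite lee_fin [leRHS]ger0_norm.
    by apply: HM => //; rewrite lexx.
  by apply: (le_trans (normr_ge0 _) (HM x w _ Sw)); rewrite lexx.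
- exact: finite_measure_integrable_cst.
Qed.

(** Dominated convergence: for arguments within distance 1 of [x] the integrand is bounded by a
    constant on [S], and constants are integrable for the finite measure [nu]. *)
Lemma continuous_compact_convolution :
  continuous (fun x : R => \int[nu]_(w in S) f (x - w)).
Proof.
move=> x.
have [M HM] := bounded (x - 1) (x + 1).
apply: (@continuity_under_integral R _ _ nu (fun x w => f (x - w)) S mS
  (x - 1) (x + 1) _ _ (cst M)).
- by move=> y _; exact: integrable_compact_convolution.
- apply: aeW => w _ y _; apply: continuous_comp; last exact: cf.
  by apply: cvgB; [exact: cvg_id|exact: cvg_cst].
- exact: finite_measure_integrable_cst.
- move=> y; rewrite /= in_itv/= => /andP[/ltW ? /ltW ?].
  by apply: aeW => w Sw; apply: HM => //; apply/andP.
- by rewrite inE/= in_itv/= ltrDl gtrBl ltr01.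
Qed.

End compact_convolution.

(** * Restricted densities *)

Section past.
Context d (T : measurableType d) (R : realType) (P : probability T R).
Variables (s : nat) (Y : nat -> {RV P >-> R}) (S : nat -> set R).
Hypothesis mS : forall j, (1 <= j <= s)%N -> measurable (S j).

Definition past (j : nat) : set T :=
  [set w | forall i, (1 <= i < j)%N -> S i (Y i w)].

Lemma pastS j : (0 < j)%N -> past j.+1 = Y j @^-1` S j `&` past j.
Proof.
move=> j0; apply/seteqP; split => [w wp|w [wj wp] i].
  split; first by apply: wp; rewrite j0 /=.
  by move=> i /andP[i0 ij]; apply: wp; rewrite i0 (ltn_trans ij).
rewrite ltnS (leq_eqVlt i) => /andP[i0 /predU1P[->//|ij]].
by apply: wp; rewrite i0.
Qed.

Lemma measurable_past j : (j <= s.+1)%N -> measurable (past j).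
Proof.
elim: j => [_|[_ _|j ih js]].
- rewrite (_ : past 0 = setT); first exact: measurableT.
  by apply/seteqP; split => // w _ i; rewrite ltn0 andbF.
- rewrite (_ : past 1 = setT); first exact: measurableT.
  by apply/seteqP; split => // w _ [|i].
- rewrite pastS//; apply: measurableI; last by apply: ih; exact: ltnW.
  rewrite -[X in measurable X]setTI.
  by apply: measurable_funPT => //; exact: mS.
Qed.

Lemma restricted_cdfE j (mE : measurable (past j))
    (mY : measurable_fun [set: T] (Y j)) (y : R) :
  restricted_cdf P Y S j y = fine (real_law P mE mY `]-oo, y[%classic).
Proof.
by rewrite /restricted_cdf; congr (fine (P _)).
Qed.

End past.

(** * Recursion for the laws and their densities *)

Section recursion.
Context d (T : measurableType d) (R : realType) (P : probability T R).
Local Notation mu := (@lebesgue_measure R).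
Variables (s : nat) (Y : nat -> {RV P >-> R}) (S : nat -> set R).
Variables (f g : nat -> R -> R).
Hypothesis mS : forall j, (1 <= j <= s)%N -> measurable (S j).
Hypothesis indY : independent_increments P s Y.
Hypothesis f_density :
  forall j, (1 <= j < s)%N -> is_density P (increment Y j) (f j).
Hypothesis g_def : is_restricted_density_seq P s Y S g.

Let mY j : measurable_fun [set: T] (Y j).
Proof. exact: measurable_funPT. Qed.

Definition past_law j (mE : measurable (past Y S j)) :=
  real_law P mE (mY j).

(** [Y j.+1] is [Y j] plus an increment independent of Y_1, ..., Y_j, so [sum_law] applies with
    [past Y S j] as the conditioning event. *)
Lemma past_law_succ j (mE : measurable (past Y S j))
    (mE' : measurable (past Y S j.+1)) (B : set R) :
  (1 <= j < s)%N -> measurable B ->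
  past_law mE' B =
  (\int[mu]_(x in B) \int[past_law mE]_(w in S j) (f j (x - w))%:E)%E.
Proof.
move=> js mB; have /andP[j0 jlts] := js.
have mSj : measurable (S j) by apply: mS; rewrite j0 ltnW.
have mZ : measurable_fun setT (increment Y j) by exact: measurable_funB.
transitivity (P ((Y j \+ increment Y j) @^-1` B `&`
    (Y j @^-1` S j `&` past Y S j))).
  rewrite -pastS//; congr (P (_ `&` _)).
  by apply/seteqP; split=> t /=; rewrite /increment addrC subrK.
apply: (@sum_law _ T R P _ (Y j) (increment Y j) (S j) (f j) mE (mY j)) => //.
- exact: f_density.
- move=> A C mA mC.
  (* The event on [Y j] and its past is a box in Y_1, ..., Y_j. The value [setT] elsewhere is a
     default, as independence asks for measurable sides at every index. *)
  pose box i := if i == j then C else if (1 <= i < j)%N then S i else setT.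
  have mbox i : measurable (box i).
    rewrite /box; case: ifP => // _; case: ifP => // /andP[i0 ij].
    by apply: mS; rewrite i0 ltnW// (ltn_trans ij).
  have -> : Y j @^-1` C `&` past Y S j =
      \bigcap_(i in [set i | (1 <= i <= j)%N]) (Y i @^-1` box i).
    apply/seteqP; split => [w [Cw pw] i /= /andP[i0]|w wbox].
      rewrite leq_eqVlt => /predU1P[->|ij]; first by rewrite /box eqxx.
      by rewrite /box ltn_eqF// i0 ij /=; apply: pw; rewrite i0.
    split; first by have := wbox j; rewrite /= /box eqxx; apply; rewrite j0 /=.
    move=> i /andP[i0 ij]; have := wbox i.
    by rewrite /= /box ltn_eqF// i0 ij /=; apply; rewrite ltnW.
  exact: indY.2.
Qed.

(** For j = 1 the law lies below that of [Y 1], which has density [g 1]; for later indices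
    [past_law_succ] exhibits a density. *)
Lemma past_law_dominated j (mE : measurable (past Y S j)) :
  (1 <= j <= s)%N -> past_law mE `<< mu.
Proof.
case: j mE => [//|[|j]] mE js; apply/null_content_dominatesP => A mA A0.
  have [mf _ fE] := g_def.1.
  apply/eqP; rewrite -measure_le0.
  rewrite -(@null_set_integral _ _ _ mu A (EFin \o g 1))//.
    have mYA : measurable (Y 1 @^-1` A).
      by rewrite -[X in measurable X]setTI; exact: mY.
    by rewrite -fE//; apply: le_measure; rewrite ?inE//; exact: measurableI.
  by apply: measurable_funTS; exact/measurable_EFinP.
have mE' : measurable (past Y S j.+1).
  by apply: (measurable_past Y mS); rewrite ltnW// ltnW.
have mSj : measurable (S j.+1) by apply: mS; rewrite /= ltnW.
have js1 : (1 <= j.+1 < s)%N by exact: js.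
have [mf f0 _] := f_density js1.
rewrite (past_law_succ mE')// null_set_integral//.
by apply: measurable_funTS; exact: measurable_convolution.
Qed.

(** The restricted distribution function is the indefinite integral of the Radon-Nikodym derivative.
    Lebesgue differentiation recovers the latter almost everywhere, and [g j] equals the derivative
    wherever it exists. *)
Lemma derivative_past_law j (mE : measurable (past Y S j)) :
  (1 <= j <= s)%N ->
  {ae mu, forall x,
     Radon_Nikodym_SigmaFinite.f (past_law mE) mu x = (g j x)%:E}.
Proof.
move=> js.
have dom := past_law_dominated mE js.
pose RN := Radon_Nikodym_SigmaFinite.f (past_law mE) mu.
have RNfin x : RN x \is a fin_num by exact: Radon_Nikodym_SigmaFinite.f_fin_num.
have RNE : EFin \o (fine \o RN) = RN.
  by apply/funext => x /=; rewrite fineK.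
have RNint : mu.-integrable setT RN.
  exact: Radon_Nikodym_SigmaFinite.f_integrable.
have rint D : measurable D -> mu.-integrable D (EFin \o (fine \o RN)).
  by move=> mD; rewrite RNE; exact: integrableS RNint.
have lint : locally_integrable [set: R] (fine \o RN).
  by apply: open_integrable_locally; [exact: openT|exact: rint].
have cdfE : restricted_cdf P Y S j =
    fun x => \int[mu]_(t in `]-oo, x]) (fine \o RN) t.
  apply/funext => x; rewrite (restricted_cdfE mE (mY j)); congr fine.
  (* [restricted_cdf] uses a strict inequality; the endpoint is Lebesgue null. *)
  rewrite -integral_itv_bndo_bndc; last exact: measurable_int (rint _ _).
  under eq_integral do rewrite /= fineK//.
  exact: (Radon_Nikodym_SigmaFinite.f_integral dom).
have := @FTC1Ny R (fine \o RN) (fun y => rint _ (measurable_itv _)) lint.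
rewrite /= -cdfE; apply: filterS; first exact: (ae_filter_ringOfSetsType mu).
move=> x [dx Dx].
by rewrite g_def.2// Dx /= fineK.
Qed.

(** The equality holds at every point because the density is continuous, so the fundamental theorem
    of calculus also proves differentiability. Integrating against the law avoids any choice of
    version of [g j]. *)
Lemma restricted_density_succ j (mE : measurable (past Y S j)) (a b : R) :
  (1 <= j < s)%N -> S j `<=` `[a, b]%classic -> continuous (f j) ->
  forall y, g j.+1 y = \int[past_law mE]_(w in S j) f j (y - w).
Proof.
move=> js Sab cf y; have /andP[j0 jlts] := js.
have mSj : measurable (S j) by apply: mS; rewrite j0 ltnW.
have [mf f0 _] := f_density js.
have mE' : measurable (past Y S j.+1).
  by apply: (measurable_past Y mS); rewrite ltnS ltnW.
pose k x := \int[past_law mE]_(w in S j) f j (x - w).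
have kE x : (k x)%:E = (\int[past_law mE]_(w in S j) (f j (x - w))%:E)%E.
  rewrite /k /Rintegral fineK//; apply: integrable_fin_num => //.
  exact: integrable_compact_convolution Sab cf _.
have lawE B : measurable B -> past_law mE' B = (\int[mu]_(x in B) (k x)%:E)%E.
  by move=> mB; under eq_integral do rewrite kE; exact: past_law_succ.
have ck : continuous k by exact: continuous_compact_convolution Sab cf.
have k0 x : 0 <= k x by rewrite /k; apply: Rintegral_ge0.
have mk : measurable_fun [set: R] k by exact: continuous_measurable_fun.
have kint D : measurable D -> mu.-integrable D (EFin \o k).
  (* The total integral of [k] is the mass of the law at j + 1, which is finite. *)
  move=> mD; apply: (integrableS measurableT) => //.
  apply/integrableP; split; first exact/measurable_EFinP.
  under eq_integral do rewrite /= ger0_norm//.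
  rewrite -(lawE setT measurableT) -ge0_fin_numE//.
  exact: fin_num_measure.
have cdfE : restricted_cdf P Y S j.+1 =
    fun x => \int[mu]_(t in `]-oo, x]) k t.
  apply/funext => x; rewrite (restricted_cdfE mE' (mY j.+1)); congr fine.
  rewrite -integral_itv_bndo_bndc; last exact: measurable_int (kint _ _).
  exact: lawE.
have [dF DF] : derivable (restricted_cdf P Y S j.+1) y 1 /\
    derive1 (restricted_cdf P Y S j.+1) y = k y.
  rewrite cdfE; apply: (@continuous_FTC1 R k -oo%O y (y + 1)).
  - by rewrite ltrDl.
  - exact: kint.
  - by rewrite ltNyr.
  - exact: ck.
by rewrite g_def.2.
Qed.

End recursion.

(** * Integral bounds *)

Section consecutive_intervals.
Context {R : realType}.
Local Notation mu := (@lebesgue_measure R).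
Variables (m : nat) (A B : nat -> R).
Hypothesis AB : forall i, (1 <= i <= m)%N -> A i <= B i.
Hypothesis BA : forall i, (1 <= i <= m - 1)%N -> B i <= A i.+1.

Let I := index_iota 1 m.+1.
Let S := \bigcup_(i in [set i | (1 <= i <= m)%N]) `[A i, B i]%classic.

Lemma consecutive_ler (i j : nat) : (1 <= i)%N -> (i < j <= m)%N -> B i <= A j.
Proof.
move=> i1; elim: j => [//|j ih ijm].
have [eij|ij] := eqVneq i j; first by rewrite eij; apply: BA; lia.
apply: le_trans (ih _) _; first by lia.
by apply: le_trans (AB _) (BA _); lia.
Qed.

(** Supplies the compact interval required by [restricted_density_succ]. *)
Lemma consecutive_itv_bounded : S `<=` `[A 1%N, B m]%classic.
Proof.
move=> x [i /= im]; rewrite !in_itv/= => /andP[Ax xB]; apply/andP; split.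
  apply: le_trans Ax; have [->//|i1] := eqVneq i 1%N.
  apply: (@le_trans _ _ (B 1%N)); first by apply: AB; lia.
  by apply: consecutive_ler; lia.
apply: (le_trans xB); have [->//|i1] := eqVneq i m.
apply: (@le_trans _ _ (A m)); last by apply: AB; lia.
by apply: consecutive_ler; lia.
Qed.

(** Neighbouring intervals may share an endpoint. One inequality bounds the indicator of the union
    by the sum of the indicators; the other uses disjoint half-open intervals. *)
Lemma ge0_integral_intervals (phi : R -> \bar R) :
  measurable_fun [set: R] phi -> (forall x, 0 <= phi x)%E ->
  (\int[mu]_(x in S) phi x =
   \sum_(1 <= i < m.+1) \int[mu]_(x in `[A i, B i]) phi x)%E.
Proof.
move=> mphi phi0.
have mI (i : nat) : i \in I = (1 <= i <= m)%N.
  by rewrite mem_index_iota ltnS.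
have mS : measurable S by apply: bigcup_measurable.
apply/eqP; rewrite eq_le; apply/andP; split.
  rewrite integral_mkcond.
  under eq_bigr do rewrite integral_mkcond.
  rewrite -ge0_integral_sum//; last 2 first.
  - move=> i; apply/(measurable_restrictT _ _).1 => //.
    exact: measurable_funTS.
  - by move=> i x _; apply: erestrict_ge0.
  apply: ge0_le_integral => //.
  - by move=> x _; apply: erestrict_ge0.
  - by apply/(measurable_restrictT _ _).1 => //; exact: measurable_funTS.
  - apply: emeasurable_sum => i.
    by apply/(measurable_restrictT _ _).1 => //; exact: measurable_funTS.
  - move=> x _; rewrite {1}/patch; case: ifPn => [|_]; last first.
      by apply: sume_ge0 => i _; exact: erestrict_ge0.
    rewrite inE => -[i /= im xi].
    rewrite (bigD1_seq i)/= ?mI ?iota_uniq// {1}/patch mem_set//.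
    by apply: leeDl; apply: sume_ge0 => k _; exact: erestrict_ge0.
(* Dropping the left endpoints keeps the integrals and makes the intervals disjoint. *)
rewrite (eq_bigr (fun i => \int[mu]_(x in `]A i, B i]) phi x)%E); last first.
  by move=> i _; rewrite integral_itv_obnd_cbnd//; exact: measurable_funTS.
rewrite -(@ge0_integral_bigsetU _ _ _ mu _ (fun i => `]A i, B i]%classic))//.
- apply: ge0_subset_integral => //; first exact: bigsetU_measurable.
    exact: measurable_funTS.
  rewrite -bigcup_seq => x [i /=]; rewrite mI => im xi; exists i => //=.
  exact: subset_itv_oc_cc xi.
- exact: iota_uniq.
- apply/trivIsetP => i j; rewrite /= !mI => im jm.
  have disj k n : (1 <= k)%N -> (k < n <= m)%N ->
      `]A k, B k]%classic `&` `]A n, B n]%classic = set0.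
    move=> k1 kn; rewrite -subset0 => x [] /=; rewrite !in_itv/= => /andP[_ xB].
    by rewrite ltNge (le_trans xB (consecutive_ler k1 kn)).
  rewrite neq_ltn => /orP[ij|ji]; first by apply: disj; lia.
  by rewrite setIC; apply: disj; lia.
- exact: measurable_funTS.
Qed.

(** Against [nu] one integrates [f (y - x)] times the Radon-Nikodym derivative. On each interval the
    latter is almost everywhere [rho], hence between [lo * h i] and [hi * h i]. The intended case is
    [rho] = g_l with factors 1 -+ eps_l. *)
Lemma integral_bounds_density
    (nu : {finite_measure set (measurableTypeR R) -> \bar R})
    (f rho : R -> R) (h : nat -> R) (lo hi : R) (y : R) :
  nu `<< mu -> continuous f -> (forall x, 0 <= f x) ->
  {ae mu, forall x, Radon_Nikodym_SigmaFinite.f nu mu x = (rho x)%:E} ->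
  0 <= lo -> 0 <= hi -> (forall i, (1 <= i <= m)%N -> 0 <= h i) ->
  (forall i, (1 <= i <= m)%N -> forall x, x \in `[A i, B i] ->
     lo * h i <= rho x <= hi * h i) ->
  lo * (\sum_(1 <= i < m.+1) h i * \int[mu]_(u in `[A i, B i]) f (y - u))
    <= \int[nu]_(w in S) f (y - w) /\
  \int[nu]_(w in S) f (y - w) <=
  hi * (\sum_(1 <= i < m.+1) h i * \int[mu]_(u in `[A i, B i]) f (y - u)).
Proof.
move=> numu cf f0 rhoE lo0 hi0 h0 rhoB.
pose RN := Radon_Nikodym_SigmaFinite.f nu mu.
have RN0 x : (0 <= RN x)%E by exact: Radon_Nikodym_SigmaFinite.f_ge0.
have mRN : measurable_fun [set: R] RN.
  exact: measurable_int (Radon_Nikodym_SigmaFinite.f_integrable numu).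
pose F x := (f (y - x))%:E.
have mF : measurable_fun [set: R] F.
  apply/measurable_EFinP; apply: measurableT_comp; last exact: measurable_funB.
  exact: continuous_measurable_fun.
have F0 x : (0 <= F x)%E by rewrite lee_fin.
have mS : measurable S by apply: bigcup_measurable.
have mFRN : measurable_fun [set: R] (fun x => F x * RN x)%E.
  exact: emeasurable_funM.
have FRN0 x : (0 <= F x * RN x)%E by exact: mule_ge0.
have E1 : (\int[nu]_(w in S) F w =
    \sum_(1 <= i < m.+1) \int[mu]_(x in `[A i, B i]) (F x * RN x))%E.
  rewrite -ge0_integral_intervals//.
  rewrite -(Radon_Nikodym_SigmaFinite.change_of_variables numu)//.
  exact: measurable_funTS.
have Fint i : (\int[mu]_(x in `[A i, B i]) F x =
    (\int[mu]_(u in `[A i, B i]) f (y - u))%:E)%E.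
  rewrite /Rintegral fineK//; apply: integrable_fin_num => //.
  apply: continuous_compact_integrable; first exact: segment_compact.
  apply: continuous_subspaceT => x; apply: continuous_comp; last exact: cf.
  by apply: cvgB; [exact: cvg_cst|exact: cvg_id].
have sumE c : (c * (\sum_(1 <= i < m.+1)
     h i * \int[mu]_(u in `[A i, B i]) f (y - u)))%:E =
   (\sum_(1 <= i < m.+1) (c * h i)%:E * \int[mu]_(x in `[A i, B i]) F x)%E.
  rewrite mulr_sumr -sumEFin; apply: eq_bigr => i _.
  by rewrite Fint -EFinM mulrA.
have sum_fin c : (\sum_(1 <= i < m.+1)
    (c * h i)%:E * \int[mu]_(x in `[A i, B i]) F x)%E \is a fin_num.
  by rewrite -sumE.
have loE : ((lo * (\sum_(1 <= i < m.+1)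
    h i * \int[mu]_(u in `[A i, B i]) f (y - u)))%:E <=
    \int[nu]_(w in S) F w)%E.
  rewrite sumE E1 big_nat_cond [leRHS]big_nat_cond.
  apply: lee_sum => i /andP[im _]; rewrite ltnS in im.
  rewrite -ge0_integralZl_EFin//; last 2 first.
  - exact: measurable_funTS.
  - by rewrite mulr_ge0// h0.
  apply: ae_ge0_le_integral => //.
  - by move=> x _; rewrite mule_ge0// lee_fin mulr_ge0// h0.
  - by apply: measurable_funTS; exact: measurable_funeM.
  - exact: measurable_funTS.
  - move: rhoE; apply: filterS.
    move=> x RNE xAB; rewrite /RN RNE muleC lee_wpmul2l// lee_fin.
    by have /andP[] := rhoB i im x xAB.
have hiE : (\int[nu]_(w in S) F w <= (hi * (\sum_(1 <= i < m.+1)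
    h i * \int[mu]_(u in `[A i, B i]) f (y - u)))%:E)%E.
  rewrite sumE E1 big_nat_cond [leRHS]big_nat_cond.
  apply: lee_sum => i /andP[im _]; rewrite ltnS in im.
  rewrite -ge0_integralZl_EFin//; last 2 first.
  - exact: measurable_funTS.
  - by rewrite mulr_ge0// h0.
  apply: ae_ge0_le_integral => //.
  - exact: measurable_funTS.
  - by move=> x _; rewrite mule_ge0// lee_fin mulr_ge0// h0.
  - by apply: measurable_funTS; exact: measurable_funeM.
  - move: rhoE; apply: filterS.
    move=> x RNE xAB; rewrite /RN RNE [leRHS]muleC lee_wpmul2l// lee_fin.
    by have /andP[] := rhoB i im x xAB.
(* The real integral would default to 0 on an infinite value; the upper bound [hiE] excludes
   this. *)
have kE : (\int[nu]_(w in S) F w)%E = (\int[nu]_(w in S) f (y - w))%:E.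
  rewrite /Rintegral fineK// ge0_fin_numE; last first.
    by apply: integral_ge0 => w _; exact: F0.
  by apply: le_lt_trans hiE _; exact: ltry.
by move: loE hiE; rewrite kE !lee_fin.
Qed.

End consecutive_intervals.

(** * Algebra of the constants *)

Section bracketing.
Context {R : realFieldType}.

Lemma increasing_unit_seq (s : nat) (eps : nat -> R) : 0 < eps 1%N ->
  (forall j, (1 <= j < s)%N -> eps j < eps j.+1) -> eps s < 1 ->
  forall j, (1 <= j <= s)%N -> 0 < eps j < 1.
Proof.
move=> eps_gt0 eps_incr eps_lt1 j js; apply/andP; split.
  elim: j js => [//|[//|j] ih js].
  by apply: lt_trans (ih _) (eps_incr _ _); lia.
(* Downward induction from [s], run on the distance [s - j]. *)
rewrite -(subKn (andP js).2); have : (s - j < s)%N by lia.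
elim: (s - j)%N => [|n ih] ns; first by rewrite subn0.
have := eps_incr (s - n.+1)%N.
have -> : ((s - n.+1).+1 = s - n)%N by lia.
by move=> lt_eps; apply: lt_trans (lt_eps _) (ih _); lia.
Qed.

(** With [k] the product in the denominator, the hypothesis reads (1 + e)(1 + k) <= 2, that is k (1
    + e) <= 1 - e; it remains to clear the denominators of [k]. *)
Lemma eps_bound_cleared (e e' eta gamma : R) :
  0 < e -> 0 < e' < 1 -> 0 < eta < 1 -> 0 < gamma ->
  e <= 2 / (1 + (1 - e') / (1 + e') * ((1 + eta) * (1 + gamma) / (1 - eta)))
       - 1 ->
  (1 - e') * ((1 + eta) * (1 + gamma)) * (1 + e) <=
  (1 + e') * (1 - eta) * (1 - e).
Proof.
move=> e0 /andP[e'0 e'1] /andP[eta0 eta1] gamma0.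
set k := _ / _ * _ => ebound.
have k0 : 0 < k.
  by rewrite mulr_gt0// divr_gt0//; [lra|lra|rewrite mulr_gt0//; lra|lra].
have kE : (1 - e') * ((1 + eta) * (1 + gamma)) = k * ((1 + e') * (1 - eta)).
  by rewrite /k; field; apply/andP; split; lra.
have : (1 + e) * (1 + k) <= 2 by rewrite -ler_pdivlMr; lra.
move=> ek; rewrite kE mulrAC -[leRHS]mulrA [leRHS]mulrCA -mulrA.
have c0 : 0 < (1 + e') * (1 - eta) by rewrite mulr_gt0//; lra.
nra.
Qed.

End bracketing.

Section bracketing_real.
Context {R : realType}.

(** [next_h] is (X + Z) / 4, and bracketing gives Z / 2 < G < X / 2. The bound on [e] and the
    proviso give (1 - e') X < (1 + e') Z, which puts (1 - e') (X + Z) / 4 below Z / 2 and (1 + e')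
    (X + Z) / 4 above X / 2. *)
Lemma next_h_bounds (e e' eta gamma Shi Slo Lhi Uhi Llo Ulo J G : R) :
  0 < e < 1 -> 0 < e' < 1 -> 0 < eta < 1 ->
  (1 - e') * ((1 + eta) * (1 + gamma)) * (1 + e) <=
    (1 + e') * (1 - eta) * (1 - e) ->
  bracketing eta Shi Slo Lhi Uhi Llo Ulo ->
  (1 + gamma) * (Llo + Ulo) > Lhi + Uhi ->
  Slo <= J <= Shi -> (1 - e) * J <= G <= (1 + e) * J ->
  (1 - e') * next_h e eta Lhi Uhi Llo Ulo < G /\
  G < (1 + e') * next_h e eta Lhi Uhi Llo Ulo.
Proof.
move=> /andP[e0 e1] /andP[e'0 e'1] /andP[eta0 eta1] eb.
case=> -[Lhi0 Uhi0 Llo0 Ulo0] [LS SU UL] [US SL LU] prov.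
move=> /andP[SJ JS] /andP[GJ JG].
have Uhi2 : 2 * Uhi < (1 + eta) * (Lhi + Uhi).
  have : Uhi * (1 - eta) < (1 + eta) * Lhi.
    by rewrite -ltr_pdivlMr ?subr_gt0// mulrAC.
  by lra.
have Llo2 : (1 - eta) * (Llo + Ulo) < 2 * Llo.
  have : (1 - eta) * Ulo < Llo * (1 + eta).
    by rewrite -ltr_pdivrMr ?addr_gt0// mulrAC.
  by lra.
set X := (1 + e) * (1 + eta) * (Lhi + Uhi).
set Z := (1 - e) * (1 - eta) * (Llo + Ulo).
have XZ : (1 - e') * X < (1 + e') * Z.
  have p0 : 0 < (1 - e') * (1 + eta) * (1 + e) by rewrite !mulr_gt0//; lra.
  have := ler_wpM2r (ltW (addr_gt0 Llo0 Ulo0)) eb.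
  move: prov; rewrite -(ltr_pM2l p0) /X /Z => ? ?; lra.
have UX : (1 + e) * Uhi < 2^-1 * X by rewrite /X; nra.
have ZL : 2^-1 * Z < (1 - e) * Llo by rewrite /Z; nra.
have G1 : G < (1 + e) * Uhi.
  by apply: le_lt_trans JG _; rewrite ltr_pM2l; lra.
have G2 : (1 - e) * Llo < G.
  by apply: lt_le_trans GJ; rewrite ltr_pM2l; lra.
by rewrite /next_h -/X -/Z; split; lra.
Qed.

(** Bracketing yields (1 - eta)(Lhi + Uhi) < 2 Shi and 2 Slo < (1 + eta)(Llo + Ulo), which chain
    through the comparison of [Shi] with [Slo]. *)
Lemma bracketing_proviso (eta gamma Shi Slo Lhi Uhi Llo Ulo : R) :
  0 < eta < 1 -> 0 < gamma ->
  bracketing eta Shi Slo Lhi Uhi Llo Ulo ->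
  (1 + eta) * Shi <= (1 + gamma) * (1 - eta) * Slo ->
  (1 + gamma) * (Llo + Ulo) > Lhi + Uhi.
Proof.
move=> /andP[eta0 eta1] gamma0.
case=> -[Lhi0 Uhi0 Llo0 Ulo0] [LS SU UL] [US SL LU] SS.
have U1 : (1 - eta) * (Lhi + Uhi) < 2 * Shi.
  have : Uhi * (1 - eta) < (1 + eta) * Lhi.
    by rewrite -ltr_pdivlMr ?subr_gt0// mulrAC.
  by lra.
have L1 : 2 * Slo < (1 + eta) * (Llo + Ulo).
  have : (1 - eta) * Ulo < Llo * (1 + eta).
    by rewrite -ltr_pdivrMr ?addr_gt0// mulrAC.
  by lra.
have c0 : 0 < (1 + eta) * (1 - eta) by rewrite mulr_gt0//; lra.
rewrite -(ltr_pM2l c0).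
have a0 : 0 < 1 + eta by lra.
have b0 : 0 < (1 + gamma) * (1 - eta) by rewrite mulr_gt0//; lra.
rewrite -(ltr_pM2l a0) in U1; rewrite -(ltr_pM2l b0) in L1.
lra.
Qed.

Lemma bracketing_exists (eta Shi Slo : R) : 0 < eta < 1 -> 0 < Shi -> 0 < Slo ->
  exists Lhi Uhi Llo Ulo : R, bracketing eta Shi Slo Lhi Uhi Llo Ulo.
Proof.
move=> /andP[eta0 eta1] Shi0 Slo0.
have q0 : 0 < 1 + eta by lra.
have qV0 : 0 < (1 + eta)^-1 by rewrite invr_gt0.
have qV1 : (1 + eta)^-1 < 1 by rewrite invf_lt1//; lra.
have q1 : 1 < 1 + eta by lra.
(* The ratio of each pair is (1 + eta)^2, which is below (1 + eta) / (1 - eta) since (1 + eta)(1 -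
   eta) < 1. *)
exists (Shi / (1 + eta)), (Shi * (1 + eta)).
exists (Slo / (1 + eta)), (Slo * (1 + eta)).
split; split; rewrite ?mulr_gt0//; try nra.
- rewrite (_ : _ * (Shi / _) = Shi / (1 - eta)); last by field; lra.
  by rewrite ltr_pM2l// -[ltRHS]div1r ltr_pdivlMr; nra.
- rewrite (_ : _ * (Slo * _) = Slo * (1 - eta)); last by field; lra.
  by rewrite ltr_pM2l// -[ltRHS]div1r ltr_pdivlMr; nra.
Qed.

(** Each interval has its own threshold for the gap; induction on [m] takes the minimum of these
    finitely many. *)
Lemma weighted_sum_gap (m : nat) (h A B : nat -> R) (f : R -> R)
    (Ilo Ihi : R -> R -> R -> R -> R) (e : R) :
  (forall i, (1 <= i <= m)%N -> A i <= B i) ->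
  (forall i, (1 <= i <= m)%N -> 0 <= h i) ->
  integral_bounds f Ilo Ihi -> 0 < e ->
  exists2 delta : R, 0 < delta & forall C D, 0 < D - C < delta ->
    weighted_sum m h A B Ihi C D - weighted_sum m h A B Ilo C D < e.
Proof.
rewrite /weighted_sum => AB h0 [_ gap]; elim: m e AB h0 => [|m ih] e AB h0 e0.
  by exists 1 => // C D _; rewrite !big_geq// subrr.
have e2 : 0 < e / 2 by lra.
have [|i im|d1 d10 H1] := ih (e / 2) _ _ e2.
- by move=> i im; apply: AB; lia.
- by apply: h0; lia.
have hm : 0 <= h m.+1 by apply: h0; lia.
(* Adding 1 keeps the divisor positive when the weight is 0. *)
have e3 : 0 < e / 2 / (h m.+1 + 1) by rewrite divr_gt0//; lra.
have [|d2 d20 H2] := gap (A m.+1) (B m.+1) _ _ e3; first by apply: AB; lia.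
exists (Num.min d1 d2); first by rewrite lt_min d10.
move=> C D; rewrite lt_min => /and3P[CD CD1 CD2].
rewrite !(@big_nat_recr _ _ _ m.+1)//=.
have {}H1 := H1 C D (introT andP (conj CD CD1)).
have {}H2 := H2 C D (introT andP (conj CD CD2)).
have H3 :
    h m.+1 * (Ihi (A m.+1) (B m.+1) C D - Ilo (A m.+1) (B m.+1) C D) <= e / 2.
  apply: (@le_trans _ _ (h m.+1 * (e / 2 / (h m.+1 + 1)))).
    apply: ler_wpM2l => //; apply: ltW.
    by apply: le_lt_trans H2; exact: ler_norm.
  rewrite mulrCA ler_piMr//; first lra.
  by rewrite ler_pdivrMr; lra.
lra.
Qed.

Lemma weighted_sum_bounds (m : nat) (h A B : nat -> R) (f : R -> R)
    (Ilo Ihi : R -> R -> R -> R -> R) (C D y : R) :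
  (forall i, (1 <= i <= m)%N -> A i <= B i) ->
  (forall i, (1 <= i <= m)%N -> 0 <= h i) ->
  integral_bounds f Ilo Ihi -> y \in `[C, D] ->
  weighted_sum m h A B Ilo C D <=
    \sum_(1 <= i < m.+1)
      h i * \int[@lebesgue_measure R]_(u in `[A i, B i]) f (y - u) <=
  weighted_sum m h A B Ihi C D.
Proof.
move=> AB h0 [bnd _] yCD; rewrite /weighted_sum; apply/andP; split.
  apply: ler_sum_nat => i im; apply: ler_wpM2l; first exact: h0.
  by have [] := bnd (A i) (B i) C D y (AB _ im) yCD.
apply: ler_sum_nat => i im; apply: ler_wpM2l; first exact: h0.
by have [] := bnd (A i) (B i) C D y (AB _ im) yCD.
Qed.

End bracketing_real.

(** * Bounds on g_(l+1) and the effect of a small D - C *)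

Theorem theorem13 (R : realType) (d : measure_display) (T : measurableType d)
  (P : probability T R) (s : nat) (Y : nat -> {RV P >-> R})
  (f g : nat -> R -> R) (S : nat -> set R) (eps : nat -> R)
  (indY : independent_increments P s Y)
  (f_density : forall j, (1 <= j < s)%N -> is_density P (increment Y j) (f j))
  (f_diff : forall j, (1 <= j < s)%N -> forall x, derivable (f j) x 1)
  (mS : forall j, (1 <= j <= s)%N -> measurable (S j))
  (S_support : forall j, (1 <= j <= s)%N -> S j `<=` RV_support P (Y j))
  (g_def : is_restricted_density_seq P s Y S g)
  (eps_gt0 : 0 < eps 1%N)
  (eps_incr : forall j, (1 <= j < s)%N -> eps j < eps j.+1)
  (eps_lt1 : eps s < 1)
  (l : nat) (l_range : (1 <= l <= s - 1)%N)
  (m : nat) (A B h : nat -> R)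
  (AB : forall i, (1 <= i <= m)%N -> A i <= B i)
  (S_cover : \bigcup_(i in [set i | (1 <= i <= m)%N]) `[A i, B i]%classic = S l)
  (BA : forall i, (1 <= i <= m - 1)%N -> B i <= A i.+1)
  (g_bounds : forall i, (1 <= i <= m)%N -> forall y, y \in `[A i, B i] ->
     (1 - eps l) * h i < g l y <= (1 + eps l) * h i)
  (Ilo Ihi : R -> R -> R -> R -> R)
  (I_bounds : integral_bounds (f l) Ilo Ihi)
  (eta gamma : R) (eta_gt0 : 0 < eta) (gamma_gt0 : 0 < gamma)
  (eta_gamma : (1 + gamma) * (1 - eta) > 1 + eta)
  (eps_bound : eps l <=
     2 / (1 + (1 - eps l.+1) / (1 + eps l.+1)
              * ((1 + eta) * (1 + gamma) / (1 - eta))) - 1) :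
  let Shi := weighted_sum m h A B Ihi in
  let Slo := weighted_sum m h A B Ilo in
  (* the bounds on g_(l+1) under the proviso *)
  [/\ forall C D Lhi Uhi Llo Ulo : R,
        C <= D -> `[C, D]%classic `<=` S l.+1 ->
        bracketing eta (Shi C D) (Slo C D) Lhi Uhi Llo Ulo ->
        (1 + gamma) * (Llo + Ulo) > Lhi + Uhi ->
        forall y, y \in `[C, D] ->
          (1 - eps l.+1) * next_h (eps l) eta Lhi Uhi Llo Ulo < g l.+1 y
          /\ g l.+1 y < (1 + eps l.+1) * next_h (eps l) eta Lhi Uhi Llo Ulo,
  (* the proviso holds on all small enough intervals around any point *)
      forall y0 : R, exists2 delta : R, 0 < delta &
        forall C D : R, C < D -> y0 \in `[C, D] -> `[C, D]%classic `<=` S l.+1 ->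
          D - C < delta ->
          forall Lhi Uhi Llo Ulo : R,
            bracketing eta (Shi C D) (Slo C D) Lhi Uhi Llo Ulo ->
            (1 + gamma) * (Llo + Ulo) > Lhi + Uhi
  (* uniformly where g_(l+1) is bounded away from 0, and then admissible
     constants do exist *)
    & forall sigma : R, 0 < sigma -> exists2 delta : R, 0 < delta &
        forall C D : R, C < D -> `[C, D]%classic `<=` S l.+1 -> D - C < delta ->
          (exists2 y, y \in `[C, D] & sigma <= g l.+1 y) ->
          (exists Lhi Uhi Llo Ulo : R,
             bracketing eta (Shi C D) (Slo C D) Lhi Uhi Llo Ulo /\
             (1 + gamma) * (Llo + Ulo) > Lhi + Uhi) /\
          (forall Lhi Uhi Llo Ulo : R,
             bracketing eta (Shi C D) (Slo C D) Lhi Uhi Llo Ulo ->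
             (1 + gamma) * (Llo + Ulo) > Lhi + Uhi)].
Proof.
have l1 : (1 <= l)%N by case/andP: l_range.
have ls : (1 <= l < s)%N by lia.
have [l0 lts] := andP ls.
have epsP := increasing_unit_seq eps_gt0 eps_incr eps_lt1.
have /andP[e0 e1] : 0 < eps l < 1 by apply: epsP; rewrite l0 ltnW.
have /andP[e'0 e'1] : 0 < eps l.+1 < 1 by exact: epsP.
(* Forced by [eta_gamma]: its left side must be positive. *)
have eta1 : eta < 1.
  have : 0 < (1 + gamma) * (1 - eta) by apply: lt_trans eta_gamma; lra.
  by rewrite pmulr_rgt0; lra.
(* The bounds on g_l at [A i] force (1 - eps_l) h_i < (1 + eps_l) h_i. *)
have h0 i : (1 <= i <= m)%N -> 0 <= h i.
  move=> im.
  have /andP[gl gu] : (1 - eps l) * h i < g l (A i) <= (1 + eps l) * h i.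
    by apply: g_bounds => //; rewrite in_itv/= lexx AB.
  have : 0 < 2 * eps l * h i by lra.
  by rewrite pmulr_rgt0 ?mulr_gt0// => /ltW.
have [mf f0 _] := f_density l ls.
have cf : continuous (f l).
  by move=> x; apply/differentiable_continuous/derivable1_diffP/f_diff.
have mE : measurable (past Y S l).
  by apply: (measurable_past Y mS); rewrite ltnW// ltnW.
have Sab : S l `<=` `[A 1%N, B m]%classic.
  by rewrite -S_cover; exact: consecutive_itv_bounded.
(* [J] links both sides: g_(l+1) is within factors 1 -+ eps_l of it, and on [C, D] it lies between
   [Slo] and [Shi]. *)
pose J y := \sum_(1 <= i < m.+1)
  h i * \int[@lebesgue_measure R]_(u in `[A i, B i]) f l (y - u).
have gJ y : (1 - eps l) * J y <= g l.+1 y <= (1 + eps l) * J y.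
  rewrite (restricted_density_succ mS indY f_density g_def mE ls Sab cf).
  rewrite -S_cover; apply/andP; apply: integral_bounds_density => //.
  - by apply: (past_law_dominated mS indY f_density g_def); rewrite l0 ltnW.
  - by apply: (derivative_past_law mS indY f_density g_def); rewrite l0 ltnW.
  - by lra.
  - by lra.
  - move=> i im x xAB; have /andP[gl gu] := g_bounds i im x xAB.
    by rewrite (ltW gl).
have eb := eps_bound_cleared e0 (introT andP (conj e'0 e'1))
  (introT andP (conj eta_gt0 eta1)) gamma_gt0 eps_bound.
move=> Shi Slo.
have SJ C D y : y \in `[C, D] -> Slo C D <= J y <= Shi C D.
  exact: weighted_sum_bounds.
(* By [eta_gamma], b = (1 + gamma)(1 - eta) exceeds 1 + eta. A gap below (b - (1 + eta)) t / b
   suffices: since t <= J <= Shi, it gives b (Shi - Slo) < (b - (1 + eta)) Shi, which rearranges to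
   the claim. *)
have close t : 0 < t -> exists2 delta : R, 0 < delta & forall C D, C < D ->
    D - C < delta -> (exists2 y, y \in `[C, D] & t <= J y) ->
    [/\ 0 < Shi C D, 0 < Slo C D &
        (1 + eta) * Shi C D <= (1 + gamma) * (1 - eta) * Slo C D].
  move=> t0; set b := (1 + gamma) * (1 - eta) in eta_gamma *.
  have b0 : 0 < b by lra.
  have e3 : 0 < (b - (1 + eta)) * t / b by rewrite divr_gt0// mulr_gt0//; lra.
  have [delta delta0 H] := weighted_sum_gap AB h0 I_bounds e3.
  exists delta => // C D CD DC [y yCD tJ].
  have /andP[SJ1 SJ2] := SJ C D y yCD.
  have {H} : (Shi C D - Slo C D) * b < (b - (1 + eta)) * t.
    by rewrite -ltr_pdivlMr//; apply: H; rewrite subr_gt0 CD.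
  move=> H.
  have Shi0 : 0 < Shi C D by lra.
  have key : (b - (1 + eta)) * t <= (b - (1 + eta)) * Shi C D.
    by rewrite ler_pM2l; lra.
  have SS : (1 + eta) * Shi C D <= b * Slo C D by lra.
  split => //.
  by rewrite -(pmulr_rgt0 _ b0); apply: lt_le_trans SS; rewrite mulr_gt0//; lra.
split.
- move=> C D Lhi Uhi Llo Ulo CD _ br prov y yCD.
  apply: (@next_h_bounds R _ _ eta gamma (Shi C D) (Slo C D) _ _ _ _ (J y));
    rewrite //.
  + by rewrite e0.
  + by rewrite e'0.
  + by rewrite eta_gt0.
  + exact: SJ.
- move=> y0; have [J0|J0] := ltP 0 (J y0).
    have [delta delta0 H] := close _ J0; exists delta => // C D CD yCD _ DC.
    move=> Lhi Uhi Llo Ulo br.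
    have [|_ _ SS] := H C D CD DC; first by exists y0.
    by apply: (bracketing_proviso _ gamma_gt0 br SS); rewrite eta_gt0.
  (* If J(y0) <= 0, then [Slo] <= 0 contradicts 0 < Llo < Slo: no bracketing exists and any
     threshold works. *)
  exists 1 => // C D CD yCD _ _ Lhi Uhi Llo Ulo [[_ _ Llo0 _] _ [_ SL _]].
  by have /andP[SJ1 _] := SJ C D y0 yCD; lra.
- move=> sigma sigma0.
  (* From g_(l+1) <= (1 + eps_l) J, a value of g_(l+1) at least sigma forces J to be at least this
     quotient, so the threshold depends on sigma alone and not on a point. *)
  have t0 : 0 < sigma / (1 + eps l) by rewrite divr_gt0//; lra.
  have [delta delta0 H] := close _ t0; exists delta => //.
  move=> C D CD _ DC [y yCD gy].
  have [|Shi0 Slo0 SS] := H C D CD DC.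
    exists y => //; rewrite ler_pdivrMr; last by lra.
    by have /andP[_ gJy] := gJ y; rewrite mulrC; apply: le_trans gJy.
  have prov Lhi Uhi Llo Ulo :
      bracketing eta (Shi C D) (Slo C D) Lhi Uhi Llo Ulo ->
      (1 + gamma) * (Llo + Ulo) > Lhi + Uhi.
    move=> br; apply: (bracketing_proviso _ gamma_gt0 br SS).
    by rewrite eta_gt0.
  split=> //.
  have [|Lhi [Uhi [Llo [Ulo br]]]] := @bracketing_exists R eta _ _ _ Shi0 Slo0.
    by rewrite eta_gt0.
  by exists Lhi, Uhi, Llo, Ulo; split => //; exact: prov.
Qed.
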